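(* Every PA set $A$ is weakly Kurtz engulfing.
   Context: $A$ is PA if it computes a $\{0,1\}$-valued diagonally nonrecursive function, i.e. a $g:\omega\to\{0,1\}$ with $g\le_T A$ such that $g(e)\ne\varphi_e(e)$ whenever $\varphi_e(e)$ converges ($\varphi_e$ the $e$-th partial computable function). A Kurtz test relative to $A$ is an $A$-computable sequence $(G_m)$ of clopen subsets of $2^\omega$ with $\lambda(G_m)\le 2^{-m}$ ($\lambda$ the uniform measure). $A$ is weakly Kurtz engulfing if there is an $A$-computable sequence $((G^i_m)_m)_i$ of Kurtz tests relative to $A$ such that $\bigcup_i\bigcap_m G^i_m$ contains every computable element of $2^\omega$. *)

(* Defs.v *)
From HB Require Import structures.
From Stdlib Require Cantor.
From mathcomp Require Import all_boot all_order all_algebra.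
From mathcomp Require Import finmap zify lra.
From mathcomp Require Import all_classical all_reals all_analysis.
From mathcomp Require Import measurable_realfun.

Set Implicit Arguments.
Unset Strict Implicit.
Unset Printing Implicit Defensive.

Import Order.TTheory GRing.Theory Num.Theory.
Import numFieldNormedType.Exports.

Local Open Scope classical_set_scope.
Local Open Scope nat_scope.

Definition npair (x y : nat) : nat := Cantor.to_nat (x, y).

(* Oracle Kleene programs for unary functions; several arguments are passed
   through [npair]. *)
Inductive prog :=
| PZero | PSucc | PFst | PSnd | POracle
| PPair of prog & prog
| PComp of prog & prog
| PRec of prog & prog
| PMu of prog.

(* [eval A p x y]: with oracle A, program p converges on input x with output y.
   [PRec f g] maps <a, 0> to f a and <a, n+1> to g <a, <n, r>>, where r is the
   value at <a, n>; [PMu f] maps a to the least y such that f <a, y> = 0,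
   provided that f <a, m> converges for all m < y. *)
Fixpoint eval (A : nat -> bool) (p : prog) : nat -> nat -> Prop :=
  match p with
  | PZero => fun _ y => y = 0
  | PSucc => fun x y => y = x.+1
  | PFst => fun x y => y = (Cantor.of_nat x).1
  | PSnd => fun x y => y = (Cantor.of_nat x).2
  | POracle => fun x y => y = A x
  | PPair f g => fun x y =>
      exists u v, [/\ eval A f x u, eval A g x v & y = npair u v]
  | PComp f g => fun x y => exists2 u, eval A g x u & eval A f u y
  | PRec f g => fun x =>
      let a := (Cantor.of_nat x).1 in
      (fix iter n : nat -> Prop :=
         if n is n'.+1
         then fun y => exists2 r, iter n' r & eval A g (npair a (npair n' r)) y
         else eval A f a) (Cantor.of_nat x).2
  | PMu f => fun x y =>
      eval A f (npair x y) 0 /\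
      forall m, m < y -> exists z, eval A f (npair x m) z.+1
  end.

Fixpoint encode (p : prog) : nat :=
  match p with
  | PZero => 0
  | PSucc => 1
  | PFst => 2
  | PSnd => 3
  | POracle => 4
  | PPair f g => 5 + 4 * npair (encode f) (encode g)
  | PComp f g => 6 + 4 * npair (encode f) (encode g)
  | PRec f g => 7 + 4 * npair (encode f) (encode g)
  | PMu f => 8 + 4 * encode f
  end.

(* The e-th partial computable function, as a graph: the program with number e
   is run with the empty oracle. By [encode_bij] and [eval_fun] below every e
   is the number of exactly one program and [phi e] is single-valued. *)
Definition phi (e x y : nat) : Prop :=
  exists2 p, encode p = e & eval (fun=> false) p x y.

Definition computable_in (A : nat -> bool) (f : nat -> nat) : Prop :=
  exists p, forall x, eval A p x (f x).

Definition PA (A : nat -> bool) : Prop :=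
  exists2 g : nat -> bool, computable_in A (fun e => g e) &
    forall e y, phi e e y -> g e <> y :> nat.

Lemma npair_inj x y x' y' : npair x y = npair x' y' -> x = x' /\ y = y'.
Proof. by move=> /Cantor.to_nat_inj[-> ->]. Qed.

Lemma encode_bij : bijective encode.
Proof.
rewrite -setTT_bijective; split=> //.
- move=> p q _ _; elim: p q => [|||||f IHf g IHg|f IHf g IHg|f IHf g IHg|f IHf]
    [|||||f' g'|f' g'|f' g'|f'] //= E; try lia;
  try (have /npair_inj[/IHf-> /IHg->//] :
    npair (encode f) (encode g) = npair (encode f') (encode g') by lia).
  by congr PMu; apply: IHf; lia.
- move=> n _; elim/ltn_ind: n => n IH.
  have [n5|n5] := ltnP n 5.
    case: n n5 {IH} => [|[|[|[|[|//]]]]] _.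
    + by exists PZero. + by exists PSucc. + by exists PFst.
    + by exists PSnd. + by exists POracle.
  pose q := (n - 5) %/ 4; pose r := (n - 5) %% 4.
  have nE : n = 5 + r + 4 * q by rewrite /q /r; lia.
  have r4 : r < 4 by rewrite /r; lia.
  have [f _ fE] : range encode (Cantor.of_nat q).1.
    have := Cantor.to_nat_non_decreasing (Cantor.of_nat q).1 (Cantor.of_nat q).2.
    rewrite -surjective_pairing Cantor.cancel_to_of => H; apply: IH; lia.
  have [g _ gE] : range encode (Cantor.of_nat q).2.
    have := Cantor.to_nat_non_decreasing (Cantor.of_nat q).1 (Cantor.of_nat q).2.
    rewrite -surjective_pairing Cantor.cancel_to_of => H; apply: IH; lia.
  have qE : npair (encode f) (encode g) = q.
    by rewrite fE gE /npair -surjective_pairing Cantor.cancel_to_of.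
  have [h _ hE] : range encode q by apply: IH; lia.
  clearbody r q; case: r nE r4 => [|[|[|[|//]]]] nE _.
  + by exists (PPair f g) => //=; rewrite qE; lia.
  + by exists (PComp f g) => //=; rewrite qE; lia.
  + by exists (PRec f g) => //=; rewrite qE; lia.
  + by exists (PMu h) => //=; rewrite hE; lia.
Qed.

Lemma eval_fun A p x y y' : eval A p x y -> eval A p x y' -> y = y'.
Proof.
elim: p x y y' => [|||||f IHf g IHg|f IHf g IHg|f IHf g IHg|f IHf] x y y' /=;
  try by move=> -> ->.
- move=> [u [v [fu gv ->]]] [u' [v' [fu' gv' ->]]].
  by rewrite (IHf _ _ _ fu fu') (IHg _ _ _ gv gv').
- move=> [u gu fu] [u' gu' fu'].
  by move: fu'; rewrite -(IHg _ _ _ gu gu'); exact: IHf.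
- elim: (Cantor.of_nat x).2 y y' => [|n IHn] y y' /=; first exact: IHf.
  move=> [r nr gr] [r' nr' gr'].
  by move: gr'; rewrite -(IHn _ _ nr nr'); exact: IHg.
- move=> [f0 fm] [f0' fm'].
  have [lt|lt|//] := ltngtP y y'.
  + by have [z fz] := fm' _ lt; have := IHf _ _ _ f0 fz.
  + by have [z fz] := fm _ lt; have := IHf _ _ _ f0' fz.
Qed.

Definition cylinder (s : seq bool) : set cantor_space :=
  [set X | mkseq X (size s) = s].

(* Strong indices: k codes the finite list [CodeSeq.decode k] of numbers, and
   each number n of that list codes the string [string_of n]. By
   [clopen_of_clopen] and [clopen_of_surj], this numbers the clopen sets. *)
Definition string_of (n : nat) : seq bool :=
  [seq i != 0 | i <- CodeSeq.decode n].

Definition clopen_of (k : nat) : set cantor_space :=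
  \bigcup_(n in [set` CodeSeq.decode k]) cylinder (string_of n).

Lemma cylinder_nbhs (X : cantor_space) (U : set cantor_space) :
  nbhs X U -> exists n, cylinder (mkseq X n) `<=` U.
Proof.
pose F : set_system cantor_space :=
  filter_from setT (fun n => cylinder (mkseq X n)).
have FE n m (Y : cantor_space) :
    cylinder (mkseq X n) Y -> m < n -> Y m = X m.
  rewrite /cylinder/= size_mkseq => YX mn.
  by rewrite -(nth_mkseq false Y mn) YX nth_mkseq.
have EF n (Y : cantor_space) :
    (forall m, m < n -> Y m = X m) -> cylinder (mkseq X n) Y.
  rewrite /cylinder/= size_mkseq => YX; apply/eq_in_map => i.
  by rewrite mem_iota => /andP[_ /YX].
have FF : Filter F.
  apply: filter_from_filter; first by exists 0.
  move=> i j _ _; exists (maxn i j) => // Y Yij; split; apply: EF => m mi;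
    by apply: (FE _ _ _ Yij); rewrite leq_max mi ?orbT.
suff : F --> X by move=> /[apply] -[n _ ?]; exists n.
apply/cvg_sup => i U' [B [[V oV <-] VX] BU].
by exists i.+1 => // Y YX; apply: BU; rewrite /= /proj /= (FE _ _ _ YX).
Qed.

Lemma cylinder_clopen s : clopen (cylinder s).
Proof.
have -> : cylinder s = \bigcap_(i in `I_(size s))
    ((fun X : cantor_space => X i) @^-1` [set nth false s i]).
  apply/seteqP; split=> [X /= sX i /= si|X /= sX].
    by rewrite -[in RHS]sX nth_mkseq.
  apply: (@eq_from_nth _ false); rewrite size_mkseq// => i si.
  by rewrite nth_mkseq //; exact: sX.
have c i b : clopen ((fun X : cantor_space => X i) @^-1` [set b]).
  apply: preimage_clopen.
    by split; [exact: discrete_open|exact: discrete_closed].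
  exact: (@proj_continuous _ (fun=> bool) i).
elim: (size s) => [|n IH]; first by rewrite II0 bigcap_set0; exact: clopenT.
by rewrite IIS bigcap_setU bigcap_set1; exact: clopenI.
Qed.

Lemma clopen_of_clopen k : clopen (clopen_of k).
Proof.
rewrite /clopen_of; elim: (CodeSeq.decode k) => [|n s IH].
  by rewrite set_nil bigcup_set0; exact: clopen0.
have -> : [set` n :: s] = [set n] `|` [set` s].
  apply/seteqP; split=> m /=; rewrite in_cons; first by case/predU1P; [left|right].
  by case=> [->|->]; rewrite ?eqxx ?orbT.
rewrite bigcup_setU bigcup_set1; apply: clopenU => //.
exact: cylinder_clopen.
Qed.

Lemma string_of_surj s : exists n, string_of n = s.
Proof.
exists (CodeSeq.code (map nat_of_bool s)).
rewrite /string_of CodeSeq.codeK -map_comp -[RHS]map_id.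
by apply: eq_map => -[].
Qed.

Lemma clopen_of_surj (U : set cantor_space) :
  clopen U -> exists k, clopen_of k = U.
Proof.
move=> [oU cU].
have : compact U by apply: subclosed_compact cU cantor_space_compact _.
rewrite compact_cover => /(_ nat [set n | cylinder (string_of n) `<=` U]
  (fun n => cylinder (string_of n))) [].
- by move=> n _; case: (cylinder_clopen (string_of n)).
- move=> X UX; have [n nU] := cylinder_nbhs (open_nbhs_nbhs (conj oU UX)).
  have [j jE] := string_of_surj (mkseq X n).
  by exists j; rewrite /= jE //; rewrite /cylinder/= size_mkseq.
move=> D DU UD; exists (CodeSeq.code (enum_fset D)).
rewrite /clopen_of CodeSeq.codeK; apply/seteqP; split.
  by move=> X [n nD]; apply: (set_mem (DU n nD)).
by move=> X /UD [n nD nX]; exists n.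
Qed.

Definition borel_cantor := g_sigma_algebraType (@open cantor_space).

Section uniform_measure.
Variable R : realType.
Local Open Scope ring_scope.

Definition binary_digits (x : R) : borel_cantor :=
  fun n => odd (Num.truncn (x * 2 ^+ n.+1)).

(* The law of the binary digits of a uniformly distributed point of [0, 1[;
   [uniform_measure_cylinder] gives its values 2^-|s| on cylinders, which
   determine it. *)
Definition uniform_measure : set borel_cantor -> \bar R :=
  fun S => lebesgue_measure (`[0%R, 1%R[%classic `&` binary_digits @^-1` S).

Let bval := foldl (fun v (b : bool) => v.*2 + b)%N 0%N.

Let bval_rcons s b : bval (rcons s b) = ((bval s).*2 + b)%N.
Proof. by rewrite /bval foldl_rcons. Qed.

Let bval_lt s : (bval s < 2 ^ size s)%N.
Proof.
elim/last_ind: s => [//|s b IH].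
by rewrite bval_rcons size_rcons expnS; case: b; lia.
Qed.

Let bval_inj s t : size s = size t -> bval s = bval t -> s = t.
Proof.
elim/last_ind: s t => [[]//|s b IH t]; case/lastP: t => [|t c].
  by rewrite size_rcons.
rewrite !size_rcons !bval_rcons => -[st] E.
have bc : b = c by case: (b) (c) E => -[]; lia.
by rewrite bc (IH t)//; rewrite bc in E; lia.
Qed.

Let truncn_double (y : R) : (Num.truncn (y * 2))./2 = Num.truncn y.
Proof.
have [y0|y0] := leP 0 y; last first.
  by rewrite !(truncn0Pn _ _)//; apply/negP; lra.
apply/esym/eqP; rewrite truncn_eq//.
have : 0 <= y * 2 by lra.
move=> /truncn_itv; set m := Num.truncn _.
have -> : m%:R = (m./2)%:R * 2 + (odd m)%:R :> R.
  by rewrite -[in LHS](odd_double_half m) natrD -muln2 natrM addrC.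
rewrite -[m.+1%:R]natr1.
have -> : m%:R = (m./2)%:R * 2 + (odd m)%:R :> R.
  by rewrite -[in LHS](odd_double_half m) natrD -muln2 natrM addrC.
by rewrite -[X in _ -> _ <= _ < X]natr1; case: (odd m) => /= /andP[h1 h2]; apply/andP; split; lra.
Qed.

Let bval_digits (x : R) n :
  bval (mkseq (binary_digits x) n) = (Num.truncn (x * 2 ^+ n) %% 2 ^ n)%N.
Proof.
elim: n => [|n IH]; first by rewrite modn1.
rewrite mkseqS bval_rcons IH /binary_digits.
have <- : (Num.truncn (x * 2 ^+ n.+1))./2 = Num.truncn (x * 2 ^+ n).
  by rewrite exprSr mulrA truncn_double.
set m := Num.truncn _; rewrite -[in RHS](odd_double_half m) expnS.
rewrite -!muln2 [(m./2 * 2)%N]mulnC -(modnDmr (odd m)) -muln_modr.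
have : (m./2 %% 2 ^ n < 2 ^ n)%N by rewrite ltn_mod expn_gt0.
move: (m./2 %% 2 ^ n)%N => u; move: (2 ^ n)%N => v uv.
by rewrite modn_small; case: (odd m); lia.
Qed.

Let cylinder_digits (s : seq bool) (x : R) :
  (binary_digits @^-1` cylinder s) x <->
  (Num.truncn (x * 2 ^+ size s) %% 2 ^ size s = bval s)%N.
Proof.
rewrite -bval_digits; split=> [/= <-|/bval_inj E]; first by rewrite size_mkseq.
by apply: E; rewrite size_mkseq.
Qed.

Let measurable_truncn (c : R) k :
  measurable [set x : measurableTypeR R | Num.truncn (x * c) = k].
Proof.
have m j : measurable [set x : measurableTypeR R | (j < Num.truncn (x * c))%N].
  have -> : [set x : measurableTypeR R | (j < Num.truncn (x * c))%N] =
      ( *%R^~ c) @^-1` `[j.+1%:R, +oo[%classic.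
    by apply/seteqP; split=> x; rewrite /= in_itv/= andbT truncn_gt_nat.
  rewrite -[X in measurable X]setTI.
  exact: mulrr_measurable.
case: k => [|k].
  have -> : [set x : measurableTypeR R | Num.truncn (x * c) = 0%N] =
      ~` [set x : measurableTypeR R | (0 < Num.truncn (x * c))%N].
    by apply/seteqP; split=> x /=; lia.
  exact: measurableC.
have -> : [set x : measurableTypeR R | Num.truncn (x * c) = k.+1] =
    [set x : measurableTypeR R | (k < Num.truncn (x * c))%N] `\`
    [set x : measurableTypeR R | (k.+1 < Num.truncn (x * c))%N].
  by apply/seteqP; split=> x /=; [move=> ->; split; lia|case; lia].
exact: measurableD.
Qed.

Let open_cylinders (U : set cantor_space) : open U ->
  U = \bigcup_(n in [set n | cylinder (string_of n) `<=` U])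
        cylinder (string_of n).
Proof.
move=> oU; apply/seteqP; split=> [X UX|X [n nU /nU//]].
have [n nU] := cylinder_nbhs (open_nbhs_nbhs (conj oU UX)).
have [j jE] := string_of_surj (mkseq X n).
by exists j; rewrite /= jE //; rewrite /cylinder/= size_mkseq.
Qed.

Let measurable_digits :
  measurable_fun [set: measurableTypeR R] binary_digits.
Proof.
apply: (@measurability _ _ (measurableTypeR R) borel_cantor setT binary_digits (@open cantor_space)) => [//|].
move=> _ [U oU <-]; rewrite setTI (open_cylinders oU) preimage_bigcup.
apply: bigcup_measurable => n _; set s := string_of n.
have -> : binary_digits @^-1` cylinder s =
    \bigcup_(k in [set k | (k %% 2 ^ size s = bval s)%N])
      [set x : measurableTypeR R | Num.truncn (x * 2 ^+ size s) = k].
  apply/seteqP; split=> x; rewrite cylinder_digits.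
    by move=> h; exists (Num.truncn (x * 2 ^+ size s)).
  by case=> k /= kE ->.
by apply: bigcup_measurable => k _; exact: measurable_truncn.
Qed.

Let preim_measurable (S : set borel_cantor) : measurable S ->
  measurable (binary_digits @^-1` S : set (measurableTypeR R)).
Proof. by move=> mS; rewrite -[X in measurable X]setTI; exact: measurable_digits. Qed.

Let uniform_measure0 : uniform_measure set0 = 0%E.
Proof. by rewrite /uniform_measure preimage_set0 setI0 measure0. Qed.

Let uniform_measure_ge0 S : (0 <= uniform_measure S)%E.
Proof. exact: measure_ge0. Qed.

Let uniform_measure_sigma_additive : semi_sigma_additive uniform_measure.
Proof.
move=> F mF tF mUF; rewrite /uniform_measure preimage_bigcup setI_bigcupr.
apply: measure_semi_sigma_additive.
- by move=> n; apply: measurableI => //; exact: preim_measurable.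
- apply/trivIsetP => i j _ _ ij; rewrite setIACA setIid.
  move/trivIsetP : tF => /(_ _ _ Logic.I Logic.I ij) Fij.
  by rewrite -[X in _ `&` X]/(binary_digits @^-1` (F i `&` F j)) Fij preimage_set0 setI0.
- rewrite -setI_bigcupr -preimage_bigcup.
  by apply: measurableI => //; exact: preim_measurable.
Qed.

HB.instance Definition _ := isMeasure.Build _ _ _ uniform_measure
  uniform_measure0 uniform_measure_ge0 uniform_measure_sigma_additive.

Lemma uniform_measure_cylinder s :
  uniform_measure (cylinder s) = (2 ^- size s)%:E.
Proof.
pose c : R := 2 ^+ size s; have c0 : 0 < c by rewrite exprn_gt0.
have -> : uniform_measure (cylinder s) =
    lebesgue_measure `[(bval s)%:R / c, (bval s).+1%:R / c[%classic.
  congr lebesgue_measure; apply/seteqP; split=> x.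
    move=> [+ /cylinder_digits]; rewrite /= !in_itv/= => /andP[x0 x1].
    have xc0 : 0 <= x * c by rewrite mulr_ge0// ltW.
    have lt : (Num.truncn (x * c) < 2 ^ size s)%N.
      by rewrite truncn_lt_nat// natrX gtr_pMl.
    rewrite -/c modn_small// => <-.
    by rewrite ler_pdivrMr// ltr_pdivlMr// truncn_itv.
  rewrite /= !in_itv/= ler_pdivrMr// ltr_pdivlMr// => xs.
  have x0 : 0 <= x.
    by rewrite -(pmulr_lge0 _ c0); case/andP: xs => + _; apply: le_trans.
  split.
    rewrite /= ?in_itv/= x0/= -(ltr_pM2r c0) mul1r.
    case/andP: xs => _ /lt_le_trans; apply.
    by rewrite /c -natrX ler_nat bval_lt.
  apply/cylinder_digits; rewrite -/c (truncn_def xs) modn_small//.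
rewrite lebesgue_measure_itv/= lte_fin ltr_pM2r ?invr_gt0// ltr_nat ltnSn.
by rewrite -EFinB -mulrBl -natrB// subSnn mul1r.
Qed.

Let uniform_measureT : uniform_measure setT = 1%E.
Proof.
have <- : cylinder [::] = setT by apply/seteqP; split.
by rewrite uniform_measure_cylinder/= expr0 invr1.
Qed.

HB.instance Definition _ :=
  Measure_isProbability.Build _ _ _ uniform_measure uniform_measureT.

End uniform_measure.

Definition kurtz_test (R : realType) (A : nat -> bool)
    (G : nat -> set cantor_space) : Prop :=
  (exists2 f : nat -> nat, computable_in A f &
     forall m, G m = clopen_of (f m)) /\
  forall m, (uniform_measure R (G m) <= (2 ^- m)%:E)%E.

(* An A-computable sequence of tests is given by a single A-computable function
   yielding an index of [G i m] from the pair (i, m). *)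
Definition weakly_kurtz_engulfing (R : realType) (A : nat -> bool) : Prop :=
  exists G : nat -> nat -> set cantor_space,
    [/\ exists2 f : nat -> nat, computable_in A f &
          forall i m, G i m = clopen_of (f (npair i m)),
        forall i, kurtz_test R A (G i) &
        forall X : cantor_space, computable_in (fun=> false) (fun n => X n) ->
          (\bigcup_i \bigcap_m G i m) X].

(* Main.v *)
Require Import Defs.
From mathcomp Require Import all_boot all_order all_algebra.
From mathcomp Require Import zify.
From mathcomp Require Import all_classical all_reals all_analysis.

(** Let [g] be [A]-computable, [{0,1}]-valued and diagonally nonrecursive. If
    [smn i n] is a number of a program that ignores its input and returns
    [phi_i n], then [1 - g (smn i n)] equals [phi_i n] whenever the latter is
    defined and at most 1. So the rows [h i = (n |-> 1 - g (smn i n))] form a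
    uniformly [A]-computable sequence of points containing every computable
    one, and the cylinders around the initial segments of [h i] are a Kurtz
    test capturing [h i]. *)

Set Implicit Arguments.
Unset Strict Implicit.
Unset Printing Implicit Defensive.

Local Open Scope classical_set_scope.
Local Open Scope nat_scope.

(** * Pairing and the s-m-n function *)

Definition nfst (x : nat) : nat := (Cantor.of_nat x).1.
Definition nsnd (x : nat) : nat := (Cantor.of_nat x).2.

Lemma nfst_npair x y : nfst (npair x y) = x.
Proof. by rewrite /nfst /npair Cantor.cancel_of_to. Qed.

Lemma nsnd_npair x y : nsnd (npair x y) = y.
Proof. by rewrite /nsnd /npair Cantor.cancel_of_to. Qed.

Fixpoint const_prog (n : nat) : prog :=
  if n is n'.+1 then PComp PSucc (const_prog n') else PZero.

Lemma eval_const_prog A n x : Defs.eval A (const_prog n) x n.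
Proof. by elim: n => //= n IH; exists n. Qed.

(** The formula is the [PComp] clause of [encode], written on numbers: for [i = encode p] it is the
    number of [PComp p (const_prog n)]. *)
Definition smn (i n : nat) : nat := 6 + 4 * npair i (encode (const_prog n)).

(** The composite replaces its input by [n] before running [p], so [x] is arbitrary. It may thus be
    the program's own number, which is where diagonal nonrecursiveness applies. *)
Lemma phi_smn p n x y :
  Defs.eval (fun=> false) p n y -> phi (smn (encode p) n) x y.
Proof.
move=> py; exists (PComp p (const_prog n)) => //.
by exists n => //; exact: eval_const_prog.
Qed.

(** * Closure properties of the [A]-computable functions *)

Section computable_functions.
Variable A : nat -> bool.
Implicit Types f g : nat -> nat.

Lemma eq_computable_in f g : f =1 g -> computable_in A f -> computable_in A g.
Proof. by move=> fg [p pf]; exists p => x; rewrite -fg. Qed.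

Lemma computable_id : computable_in A (fun x => x).
Proof.
exists (PPair PFst PSnd) => x /=; exists (nfst x), (nsnd x); split=> //.
by rewrite /npair -surjective_pairing Cantor.cancel_to_of.
Qed.

Lemma computable_cst n : computable_in A (fun=> n).
Proof. by exists (const_prog n) => x; exact: eval_const_prog. Qed.

Lemma computable_comp f g : computable_in A f -> computable_in A g ->
  computable_in A (fun x => f (g x)).
Proof. by move=> [p pf] [q qg]; exists (PComp p q) => x; exists (g x). Qed.

Lemma computable_succ f : computable_in A f ->
  computable_in A (fun x => (f x).+1).
Proof. by apply: computable_comp; exists PSucc. Qed.

Lemma computable_nfst f : computable_in A f ->
  computable_in A (fun x => nfst (f x)).
Proof. by apply: computable_comp; exists PFst. Qed.

Lemma computable_nsnd f : computable_in A f ->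
  computable_in A (fun x => nsnd (f x)).
Proof. by apply: computable_comp; exists PSnd. Qed.

Lemma computable_npair f g : computable_in A f -> computable_in A g ->
  computable_in A (fun x => npair (f x) (g x)).
Proof.
by move=> [p pf] [q qg]; exists (PPair p q) => x; exists (f x), (g x).
Qed.

(** [PRec] with parameter [x] itself, evaluated at [npair x (n x)]; the step then receives [x], the
    counter and the previous value packed as one number. The arithmetic below is built from
    instances of this scheme. *)
Lemma computable_rec (n b : nat -> nat) (s : nat -> nat -> nat -> nat) :
  computable_in A n -> computable_in A b ->
  computable_in A (fun z => s (nfst z) (nfst (nsnd z)) (nsnd (nsnd z))) ->
  computable_in A (fun x => nat_rect (fun=> nat) (b x) (s x) (n x)).
Proof.
move=> cn [p pb] [q qs].
pose r x := nat_rect (fun=> nat) (b (nfst x)) (s (nfst x)) (nsnd x).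
have cr : computable_in A r.
  exists (PRec p q) => x /=; rewrite -/(nfst x) /r -/(nsnd x).
  elim: (nsnd x) => [|k IH] /=; first exact: pb.
  eexists; first exact: IH.
  by have := qs (npair (nfst x)
    (npair k (nat_rect (fun=> nat) (b (nfst x)) (s (nfst x)) k)));
    rewrite !(nfst_npair, nsnd_npair).
apply: eq_computable_in (computable_comp cr (computable_npair computable_id cn)).
by move=> x; rewrite /r nfst_npair nsnd_npair.
Qed.

Lemma computable_double f : computable_in A f ->
  computable_in A (fun x => (f x).*2).
Proof.
move=> cf.
pose d x := nat_rect (fun=> nat) 0 (fun _ r => r.+2) (f x).
apply: (@eq_computable_in d); first by move=> x; rewrite /d; elim: (f x) => //= n ->.
apply: (computable_rec (b := fun=> 0) (s := fun _ _ r => r.+2)) => //.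
  exact: computable_cst.
by do 2!apply: computable_succ; do 2!apply: computable_nsnd; exact: computable_id.
Qed.

(** [CodeSeq.code] sends [n :: s] to [2 ^ n] times an odd number, so list codes only require
    products of this shape, obtained by iterated doubling. *)
Lemma computable_expn_mul f g : computable_in A f -> computable_in A g ->
  computable_in A (fun x => 2 ^ f x * g x).
Proof.
move=> cf cg.
pose d x := nat_rect (fun=> nat) (g x) (fun _ r => r.*2) (f x).
apply: (@eq_computable_in d).
  by move=> x; rewrite /d; elim: (f x) => /= [|n ->]; rewrite ?expnS; lia.
apply: (computable_rec (s := fun _ _ r => r.*2)) => //.
by apply: computable_double; do 2!apply: computable_nsnd; exact: computable_id.
Qed.

Lemma computable_pred f : computable_in A f ->
  computable_in A (fun x => (f x).-1).
Proof.
move=> cf.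
pose d x := nat_rect (fun=> nat) 0 (fun k _ => k) (f x).
apply: (@eq_computable_in d); first by move=> x; rewrite /d; case: (f x).
apply: (computable_rec (b := fun=> 0) (s := fun _ k _ => k)) => //.
  exact: computable_cst.
by apply: computable_nfst; apply: computable_nsnd; exact: computable_id.
Qed.

Lemma computable_subn f g : computable_in A f -> computable_in A g ->
  computable_in A (fun x => f x - g x).
Proof.
move=> cf cg.
pose d x := nat_rect (fun=> nat) (f x) (fun _ r => r.-1) (g x).
apply: (@eq_computable_in d).
  by move=> x; rewrite /d; elim: (g x) => /= [|n ->]; lia.
apply: (computable_rec (s := fun _ _ r => r.-1)) => //.
by apply: computable_pred; do 2!apply: computable_nsnd; exact: computable_id.
Qed.

Lemma computable_PComp_code f g : computable_in A f -> computable_in A g ->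
  computable_in A (fun x => 6 + 4 * npair (f x) (g x)).
Proof.
move=> cf cg.
apply: (@eq_computable_in (fun x => (npair (f x) (g x)).*2.*2.+4.+2)).
  by move=> x; lia.
do 6!apply: computable_succ; do 2!apply: computable_double.
exact: computable_npair.
Qed.

Lemma computable_smn f g : computable_in A f -> computable_in A g ->
  computable_in A (fun x => smn (f x) (g x)).
Proof.
move=> cf cg; apply: computable_PComp_code => //.
(* The recursion mirrors [const_prog]: [d x] is [encode (const_prog (g x))], where 0 and 1 are the
   numbers of [PZero] and [PSucc]. *)
pose d x := nat_rect (fun=> nat) 0 (fun _ r => 6 + 4 * npair 1 r) (g x).
apply: (@eq_computable_in d); first by move=> x; rewrite /d; elim: (g x) => //= n ->.
apply: (computable_rec (b := fun=> 0) (s := fun _ _ r => 6 + 4 * npair 1 r)) => //.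
  exact: computable_cst.
apply: computable_PComp_code; first exact: computable_cst.
by do 2!apply: computable_nsnd; exact: computable_id.
Qed.

(* The recursion runs backwards because [CodeSeq.code] is a right fold. *)
Lemma code_mkseq (h : nat -> nat) m :
  nat_rect (fun=> nat) 0 (fun k r => 2 ^ h (m - k.+1) * r.*2.+1) m =
  CodeSeq.code (mkseq h m).
Proof.
rewrite /mkseq -[in iota 0 m](subnn m).
(* Invariant: after [k] steps the accumulator codes the last [k] entries. *)
suff H k : k <= m ->
    nat_rect (fun=> nat) 0 (fun k r => 2 ^ h (m - k.+1) * r.*2.+1) k =
    CodeSeq.code [seq h i | i <- iota (m - k) k] by exact: H.
elim: k => //= k IH km; rewrite IH; last exact: ltnW.
by rewrite -[in iota (m - k) k](subnSK km).
Qed.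

Lemma computable_code_mkseq (h : nat -> nat -> nat) :
  computable_in A (fun x => h (nfst x) (nsnd x)) ->
  computable_in A (fun x => CodeSeq.code (mkseq (h (nfst x)) (nsnd x))).
Proof.
move=> ch; pose s x k r := 2 ^ h (nfst x) (nsnd x - k.+1) * r.*2.+1.
pose d x := nat_rect (fun=> nat) 0 (s x) (nsnd x).
apply: (@eq_computable_in d); first by move=> x; rewrite -code_mkseq.
have cI := computable_id.
have c1 := computable_nfst cI; have c2 := computable_nsnd cI.
apply: (computable_rec (b := fun=> 0)) => //; first exact: computable_cst.
apply: computable_expn_mul; last first.
  by apply: computable_succ; apply: computable_double; exact: computable_nsnd.
(* Here [z] packs [x], the counter and the accumulator. The two arguments of [h] are repacked into
   [y] so that [ch] applies by composition. *)
apply: (@eq_computable_in (fun z => let y :=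
    npair (nfst (nfst z)) (nsnd (nfst z) - (nfst (nsnd z)).+1) in
    h (nfst y) (nsnd y))); first by move=> z /=; rewrite nfst_npair nsnd_npair.
apply: (computable_comp ch); apply: computable_npair.
  exact: computable_nfst.
apply: computable_subn; first exact: computable_nsnd.
by apply: computable_succ; exact: computable_nfst.
Qed.

End computable_functions.

(** * Indices of cylinders and the Kurtz tests *)

Lemma clopen_of_code_singleton (s : seq bool) :
  clopen_of (CodeSeq.code [:: CodeSeq.code (map nat_of_bool s)]) = cylinder s.
Proof.
have sE : string_of (CodeSeq.code (map nat_of_bool s)) = s.
  rewrite /string_of CodeSeq.codeK -map_comp -[RHS]map_id.
  by apply: eq_map => -[].
rewrite /clopen_of CodeSeq.codeK; apply/seteqP; split=> X.
  by move=> [n /=]; rewrite inE => /eqP ->; rewrite sE.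
by move=> sX; exists (CodeSeq.code (map nat_of_bool s)); rewrite ?sE//= inE.
Qed.

Theorem theorem6 (R : realType) (A : nat -> bool) (hA : PA A) :
  weakly_kurtz_engulfing R A.
Proof.
case: hA => g cg gDNR.
pose h i n := ~~ g (smn i n).
pose seg i m := CodeSeq.code (mkseq (fun n => nat_of_bool (h i n)) m).
pose f x := CodeSeq.code [:: seg (nfst x) (nsnd x)].
have cI := computable_id A.
have cf : computable_in A f.
  (* The code of a one-element list [[:: n]] is [2 ^ n * 1]. *)
  apply: computable_expn_mul; last exact: computable_cst.
  apply: (computable_code_mkseq (h := fun i n => nat_of_bool (h i n))).
  apply: (@eq_computable_in _ (fun x => 1 - g (smn (nfst x) (nsnd x)))).
    by move=> x; rewrite /h; case: (g _).
  apply: computable_subn; first exact: computable_cst.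
  apply: (computable_comp cg).
  by apply: computable_smn; [exact: computable_nfst|exact: computable_nsnd].
have fE i m : clopen_of (f (npair i m)) = cylinder (mkseq (h i) m).
  rewrite /f /seg nfst_npair nsnd_npair -clopen_of_code_singleton.
  by rewrite /mkseq -map_comp.
exists (fun i m => clopen_of (f (npair i m))); split; first by exists f.
- move=> i; split.
    exists (fun m => f (npair i m)) => //.
    apply: (computable_comp cf).
    by apply: computable_npair => //; exact: computable_cst.
  (* The bound holds with equality: the cylinder fixes exactly [m] bits. *)
  by move=> m; rewrite fE uniform_measure_cylinder size_mkseq.
- move=> X [p pX]; exists (encode p) => // m _; rewrite fE /cylinder /=.
  rewrite size_mkseq; apply: eq_map => n; rewrite /h.
  (* Run on its own number, the program returns [X n], so [g] differs from [X n] there; as both are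
     bits, negating [g] gives [X n]. *)
  have := gDNR _ _ (phi_smn (smn (encode p) n) (pX n)).
  by case: (g _) (X n) => -[].
Qed.
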